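(* Let $n\ge 1$ and $s\ge 1$ be integers, let $r\ge 2$ be a power of $2$ such that $s$ is a multiple of $r$, and let $\mathcal F$ be a family of non-empty subsets of $[n]=\{1,\dots,n\}$. Then \[\chi(\mathrm{KG}^r(\mathcal F_s))\ge \left\lceil \frac{\mathrm{ecd}^s(\mathcal F)}{r-1}\right\rceil.\]
   Context: A subset $A\subseteq[n]$ is almost $s$-stable if $|i-j|\ge s$ for all distinct $i,j\in A$. $\mathcal F_s$ denotes the set of almost $s$-stable members of $\mathcal F$. For an integer $r\ge 2$, the Kneser hypergraph $\mathrm{KG}^r(\mathcal F_s)$ is the $r$-uniform hypergraph with vertex set $\mathcal F_s$ whose edges are the sets $\{A_1,\dots,A_r\}$ of $r$ pairwise disjoint members of $\mathcal F_s$; $\chi$ denotes its chromatic number (the least number of colors in a coloring of the vertices with no monochromatic edge). For an integer $q\ge 2$, the equitable $q$-colorability defect $\mathrm{ecd}^q(\mathcal F)$ is the minimum size of a subset $X_0\subseteq[n]$ such that there is a partition $[n]\setminus X_0=X_1\cup\dots\cup X_q$ into pairwise disjoint sets with $\big||X_i|-|X_j|\big|\le 1$ for all $1\le i,j\le q$, such that there are no $F\in\mathcal F$ and $1\le i\le q$ with $F\subseteq X_i$. (For $q=1$, the same definition with a single part $X_1=[n]\setminus X_0$.) *)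

(* Defs.v *)
(* Mathematical Components. *)
From HB Require Import structures.
From mathcomp Require Import all_boot all_order all_algebra.

Set Implicit Arguments.
Unset Strict Implicit.
Unset Printing Implicit Defensive.

Import IntDist.

(* The ground set [n] = {1, ..., n} is represented by 'I_n = {0, ..., n-1};
   only the differences |i - j| matter below. *)

Definition almost_stable (n s : nat) (A : {set 'I_n}) : bool :=
  [forall i in A, forall j in A, (i != j) ==> (s <= `|i - j|)].

Definition stable_part (n s : nat) (F : {set {set 'I_n}}) : {set {set 'I_n}} :=
  [set A in F | almost_stable s A].

Section Hypergraph.
Variable V : finType.
Implicit Types (H : {set {set V}}) (E : {set V}).

(* A hypergraph on the vertex type V is given by its set of edges. *)

Definition monochromatic (k : nat) (c : {ffun V -> 'I_k}) E : bool :=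
  [forall x in E, forall y in E, c x == c y].

Definition colorable H (k : nat) : bool :=
  [exists c : {ffun V -> 'I_k}, [forall E in H, ~~ monochromatic c E]].

(* The least k such that H is k-colorable. The search is limited to k <= #|V|,
   which loses nothing if every edge has at least two vertices (see
   chromatic_colorable and chromatic_min); a hypergraph that has no proper
   coloring gets the conventional value #|V|. *)
Definition chromatic_number H : nat :=
  [arg min_(k < @ord_max #|V| | colorable H k) k].

Lemma colorable_card H : (forall E, E \in H -> 1 < #|E|) -> colorable H #|V|.
Proof.
move=> H2; apply/existsP; exists [ffun x => enum_rank x].
apply/forall_inP => E /H2 /card_gt1P[x [y [xE yE neq_xy]]].
apply: contra neq_xy => /forall_inP/(_ x xE)/forall_inP/(_ y yE).
by rewrite !ffunE (inj_eq enum_rank_inj).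
Qed.

Lemma chromatic_colorable H :
  (forall E, E \in H -> 1 < #|E|) -> colorable H (chromatic_number H).
Proof.
by move=> H2; rewrite /chromatic_number; case: arg_minnP => //; apply: colorable_card.
Qed.

Lemma chromatic_min H k :
  (forall E, E \in H -> 1 < #|E|) -> colorable H k -> chromatic_number H <= k.
Proof.
move=> H2 colk; rewrite /chromatic_number.
case: arg_minnP => [|i _ min_i]; first exact: colorable_card.
have [ltk | gek] := ltnP k #|V|.+1; first exact: (min_i (Ordinal ltk)).
by apply: leq_trans (ltnW gek); rewrite -ltnS ltn_ord.
Qed.

End Hypergraph.

(* The vertex type is the subtype of the members of F. *)
Definition kneser (n r : nat) (F : {set {set 'I_n}}) :
    {set {set {A : {set 'I_n} | A \in F}}} :=
  [set E : {set {A : {set 'I_n} | A \in F}} | (#|E| == r) &&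
    [forall A in E, forall B in E, (A != B) ==> [disjoint val A & val B]]].

Lemma kneser_edge_gt1 n r (F : {set {set 'I_n}}) E :
  2 <= r -> E \in kneser r F -> 1 < #|E|.
Proof. by move=> r2; rewrite inE => /andP[/eqP-> _]. Qed.

(* The parts X_1, ..., X_q may be empty (as is unavoidable when
   n - |X_0| < q), hence an indexed family and not finset's partition. *)
Definition equitable_parts (n q : nat) (X0 : {set 'I_n})
    (X : {ffun 'I_q -> {set 'I_n}}) : bool :=
  [&& \bigcup_(i < q) X i == ~: X0,
      [forall i, forall j, (i != j) ==> [disjoint X i & X j]] &
      [forall i, forall j, `|(#|X i|) - #|X j| | <= 1]].

Definition ecd_admissible (n q : nat) (F : {set {set 'I_n}})
    (X0 : {set 'I_n}) : bool :=
  [exists X : {ffun 'I_q -> {set 'I_n}},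
    equitable_parts X0 X && [forall i, forall A in F, ~~ (A \subset X i)]].

(* X_0 = [n] is admissible as soon as the empty set is not in F
   (see ecd_admissibleT), so that this is a genuine minimum. *)
Definition ecd (n q : nat) (F : {set {set 'I_n}}) : nat :=
  #|[arg min_(X0 < [set: 'I_n] | ecd_admissible q F X0) #|X0| ]|.

Lemma ecd_admissibleT n q (F : {set {set 'I_n}}) :
  set0 \notin F -> ecd_admissible q F [set: 'I_n].
Proof.
move=> F0; apply/existsP; exists [ffun=> set0]; apply/andP; split; last first.
  apply/forallP => i; apply/forall_inP => A AF; rewrite ffunE subset0.
  by apply: contraNneq F0 => <-.
apply/and3P; split.
- by rewrite setCT big1 // => i _; rewrite ffunE.
- apply/forallP => i; apply/forallP => j; apply/implyP => _.
  by rewrite !ffunE -setI_eq0 setI0.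
- by apply/forallP => i; apply/forallP => j; rewrite !ffunE distnn.
Qed.

Lemma ecdP n q (F : {set {set 'I_n}}) : set0 \notin F ->
  (exists2 X0, ecd_admissible q F X0 & ecd q F = #|X0|) /\
  (forall X0, ecd_admissible q F X0 -> ecd q F <= #|X0|).
Proof.
move=> F0; rewrite /ecd; case: arg_minnP => [|X0 X0P minX0].
  exact: ecd_admissibleT.
by split => //; exists X0.
Qed.

(* Main.v *)
Require Import Defs.
From HB Require Import structures.
From mathcomp Require Import all_boot all_order all_algebra zify.

(* Call P(r, s) the statement: if the almost s-stable members of F are colored
   with t colors without r pairwise disjoint members of the same color, then one
   can remove t(r-1) points and split the rest equitably into s classes, none of
   which contains a member of F. P(1, m) holds because of the residue classes
   modulo m, and P(r, s) implies P(2r, 2s): color a set N with the common color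
   of r pairwise disjoint 2s-stable members of F inside N, if there are any.
   Disjoint sets get distinct colors, so Tucker's lemma (for the classical Kneser
   labeling by alternation number and color) gives two disjoint 2-stable uncolored
   sets which miss t points and whose sizes differ by at most 1. Inside either of
   them, an s-stable set for the induced order is 2s-stable, and P(r, s) applies.

   Octahedral Tucker lemma: over F_2, the fundamental cycle of the (k+1)-th
   sphere is b + nu(b), where nu is the antipode and the hemisphere b is the prism
   over the k-th sphere, so db is the k-th sphere. The cochain w which detects the
   flags whose labels, sorted by absolute value, alternate in sign starting with +
   satisfies dw = w + w nu. Hence w has the same integral, 1, over all spheres,
   and a flag with alternating labels needs n distinct absolute values. *)

Set Implicit Arguments.
Unset Strict Implicit.
Unset Printing Implicit Defensive.

Import IntDist.

(** * Cochains modulo 2 *)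

Section Cochains.
Variable V : Type.
Implicit Types (f g : seq V -> bool) (L M : seq V).

(** Lists stand for simplices. The empty list is the face of a one-entry list, so the complex is
    augmented. *)
Fixpoint coboundary f L : bool :=
  if L is x :: L' then f L' (+) coboundary (fun M => f (x :: M)) L' else false.

(** With $x_0$ = [p] and [L] = $x_1,\dots,x_k$, this sums [f] over the lists $x_1,\dots,x_i,\phi
    x_i,\dots,\phi x_k$ for $0\le i\le k$. The point $x_0$ occurs only through its image. *)
Fixpoint prism (phi : V -> V) (p : V) f L : bool :=
  if L is x :: L' then
    f (phi p :: phi x :: map phi L') (+) prism phi x (fun M => f (x :: M)) L'
  else f [:: phi p].

Lemma eq_coboundary f g L : f =1 g -> coboundary f L = coboundary g L.
Proof.
elim: L f g => //= x L IH f g fg.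
by rewrite fg (IH _ (fun M => g (x :: M))) // => M; apply: fg.
Qed.

Lemma coboundaryD f g L :
  coboundary (fun M => f M (+) g M) L = coboundary f L (+) coboundary g L.
Proof. by elim: L f g => //= x L IH f g; rewrite IH addbACA. Qed.

Lemma coboundary_map (nu : V -> V) f L :
  coboundary f (map nu L) = coboundary (f \o map nu) L.
Proof. by elim: L f => //= x L IH f; rewrite IH. Qed.

Variable phi : V -> V.

Lemma eq_prism p f g L : f =1 g -> prism phi p f L = prism phi p g L.
Proof.
elim: L p f g => [|x L IH] p f g fg /=; first exact: fg.
by rewrite fg (IH _ _ (fun M => g (x :: M))) // => M; apply: fg.
Qed.

Lemma prismD p f g L :
  prism phi p (fun M => f M (+) g M) L = prism phi p f L (+) prism phi p g L.
Proof. by elim: L p f g => //= x L IH p f g; rewrite IH addbACA. Qed.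

Lemma prism_base p q f L :
  prism phi p f L (+) f (phi p :: map phi L) =
  prism phi q f L (+) f (phi q :: map phi L).
Proof.
case: L => [|x L] /=; first by rewrite !addbb.
by rewrite ![f _ (+) _]addbC -!addbA !addbb.
Qed.

(** In the notation above, deleting $x_i$ from the $i$-th list gives the same face as deleting $\phi
    x_{i-1}$ from the preceding one, so these faces cancel. What remains is [L], the last list
    without $\phi x_k$, and the prisms over the faces of [L]. *)
Lemma prism_coboundary p f L :
  prism phi p (coboundary f) L = f L (+) coboundary (prism phi p f) L.
Proof.
elim: L p f => [|x L IH] p f /=; first by [].
rewrite prismD IH coboundaryD coboundary_map.
have := prism_base p x f L.
rewrite [coboundary ((fun M => f (phi p :: M)) \o _) L]/=.
set a := prism _ p f L; set b := prism _ x f L.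
set c := f (phi p :: _); set d := f (phi x :: _).
rewrite /comp /=.
set e := coboundary _ L; set e' := coboundary _ L; set h := f (x :: L).
by move: a b c d e e' h; do 7 case.
Qed.

End Cochains.

(** * Alternating sign patterns and their coboundary *)

Fixpoint alternating (c : bool) (b : seq bool) : bool :=
  if b is x :: b' then (x == c) && alternating (~~ c) b' else true.

(** In a list with one pair of equal neighbours, deleting either of them has the same result, and
    the two terms cancel. An alternating list of length at least two stays alternating only without
    its first or its last entry, and exactly one of these results starts with [c]. *)
Lemma coboundary_alternating c b :
  coboundary (alternating c) b = alternating c b (+) alternating (~~ c) b.
Proof.
elim: b c => [|x b IH] c /=; first by [].
rewrite negbK.
have [->|neq] := eqVneq x c.
  rewrite (@eq_coboundary _ _ (alternating (~~ c))) // IH negbK /=.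
  by case: c => /=; do 2 case: alternating.
(* The first entry has the wrong sign, so only its own deletion can contribute. *)
have -> : (x == ~~ c) by move: neq; case: x; case: c.
rewrite (@eq_coboundary _ _ (fun=> false)) //.
suff -> : coboundary (fun=> false) b = false by rewrite addbF.
by elim: (b) => //= ? ? ->.
Qed.

Lemma alternating_negb c b : alternating c (map negb b) = alternating (~~ c) b.
Proof. by elim: b c => //= x b IH c; rewrite IH; case: x; case: c. Qed.

Section PermCoboundary.
Variable T : eqType.

(** [rem] deletes the first occurrence of a value; a symmetric [f] cannot tell it from a later
    one. *)
Lemma coboundary_rem (f : seq T -> bool) s :
  (forall s1 s2, perm_eq s1 s2 -> f s1 = f s2) ->
  coboundary f s = \big[addb/false]_(x <- s) f (rem x s).
Proof.
elim: s f => [|x s IH] f fP /=; first by rewrite big_nil.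
rewrite big_cons eqxx; congr (_ (+) _).
rewrite IH => [|s1 s2 s12]; last by apply: fP; rewrite perm_cons.
apply: eq_big_seq => y ys /=; case: eqVneq => [->|_] //.
by apply: fP; rewrite perm_sym perm_to_rem.
Qed.

Lemma coboundary_perm (f : seq T -> bool) s s' :
  (forall s1 s2, perm_eq s1 s2 -> f s1 = f s2) -> perm_eq s s' ->
  coboundary f s = coboundary f s'.
Proof.
move=> fP ss'; rewrite !coboundary_rem // (perm_big _ ss') /=.
apply: eq_big_seq => x xs'; apply: fP; have xs : x \in s by rewrite (perm_mem ss').
by rewrite -(perm_cons x) -(permPl (perm_to_rem xs)) -(permPr (perm_to_rem xs')).
Qed.

End PermCoboundary.

Lemma coboundary_comp (V W : Type) (h : V -> W) (f : seq W -> bool) L :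
  coboundary (f \o map h) L = coboundary f (map h L).
Proof. by elim: L f => //= x L IH f; rewrite -IH. Qed.

(* A label [l] stands for the signed integer of absolute value [l./2] and sign
   [odd l]. Equal labels have equal signs, so ties do not alternate. *)
Definition alternating_labels (s : seq nat) : bool :=
  alternating true (map odd (sort leq s)).

(** As [alternating_labels] is symmetric, the labels can be sorted first, which reduces the claim to
    [coboundary_alternating]. *)
Lemma coboundary_alternating_labels s :
  coboundary alternating_labels s =
  alternating true (map odd (sort leq s)) (+)
  alternating false (map odd (sort leq s)).
Proof.
have permP s1 s2 : perm_eq s1 s2 -> alternating_labels s1 = alternating_labels s2.
  move=> s12; rewrite /alternating_labels.
  by rewrite ((perm_sortP leq_total leq_trans anti_leq _ _) s12).
rewrite (coboundary_perm permP (s' := sort leq s)); last by rewrite perm_sym perm_sort.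
rewrite -(coboundary_alternating true) -coboundary_comp.
have: sorted leq (sort leq s) by apply: sort_sorted leq_total _.
move: (sort leq s) => t.
(* all deletions of a sorted list are sorted *)
suff aux u f g : (forall M, subseq M u -> f M = g M) ->
    coboundary f u = coboundary (g : seq nat -> bool) u.
  move=> t_sorted; apply: aux => M Mt /=.
  rewrite /alternating_labels sorted_sort //; first exact: leq_trans.
  exact: (subseq_sorted leq_trans Mt).
elim: u f g => [|x u IH] f g fg //=; rewrite fg ?subseq_cons //.
by congr (_ (+) _); apply: IH => M Mu; apply: fg; rewrite /= eqxx.
Qed.

(** * The sphere of sign vectors *)

(* A sign vector in {+,-,0}^n is the pair of its positive and negative parts. *)
Definition svec n := ({set 'I_n} * {set 'I_n})%type.

Section SignVectors.
Variable n : nat.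
Implicit Types (X Y : svec n) (L M : seq (svec n)) (f g : seq (svec n) -> bool).

Definition antipode X : svec n := (X.2, X.1).

Definition vle X Y := (X.1 \subset Y.1) && (X.2 \subset Y.2).

Definition signed X := [disjoint X.1 & X.2].

Definition nonzero X := X.1 :|: X.2 != set0.

Definition below k X := [forall i in X.1 :|: X.2, i < k].

Definition vector k X := [&& signed X, nonzero X & below k X].

Definition vzero : svec n := (set0, set0).

Definition set_plus k X : svec n := (X.1 :|: [set i | val i == k], X.2).

Lemma antipodeK : involutive antipode. Proof. by case. Qed.

Lemma vle_trans : transitive vle.
Proof.
move=> Y X Z /andP[a b] /andP[c d].
by rewrite /vle (subset_trans a c) (subset_trans b d).
Qed.

Lemma vle_set_plus k X : vle X (set_plus k X).
Proof. by rewrite /vle subsetUl subxx. Qed.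

Lemma set_plus_vle k X Y : vle X Y -> vle (set_plus k X) (set_plus k Y).
Proof. by case/andP=> a b; rewrite /vle setSU. Qed.

Lemma vle_antipode X Y : vle (antipode X) (antipode Y) = vle X Y.
Proof. by rewrite /vle andbC. Qed.

Lemma vector_antipode k X : vector k (antipode X) = vector k X.
Proof. by rewrite /vector /signed /nonzero /below /= setUC disjoint_sym. Qed.

Lemma vectorS k X : vector k X -> vector k.+1 X.
Proof.
rewrite /vector => /and3P[-> -> /forall_inP b] /=; apply/forall_inP => i /b; exact: leqW.
Qed.

Lemma set_plus_vector k X :
  k < n -> signed X -> below k X -> vector k.+1 (set_plus k X).
Proof.
move=> kn dX /forall_inP bX; apply/and3P; split.
- rewrite /signed /= -setI_eq0 setIUl setU_eq0 setI_eq0 [[disjoint _ & _]]dX /=.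
  apply/eqP/setP => i; rewrite !inE; apply/negP => /andP[/eqP ik iX].
  by have := bX i; rewrite inE iX orbT ik ltnn => /(_ isT).
- by apply/set0Pn; exists (Ordinal kn); rewrite !inE eqxx orbT.
- apply/forall_inP => i; rewrite !inE => /orP[/orP[iX|/eqP->//]|iX].
    by apply/leqW/bX; rewrite inE iX.
  by apply/leqW/bX; rewrite inE iX orbT.
Qed.

(** Nonzero sign vectors below [k] stand for the proper faces of the [k]-dimensional cross-polytope,
    and strict chains of [k] of them for its complete flags. *)
Definition flag k L :=
  [&& path vle vzero L, all (vector k) L & size L == k].

(** Evaluation on the fundamental cycle of the $(k-1)$-sphere; for [k] = 0 this is the empty
    simplex. The coordinate [k'] is positive at the top of the first hemisphere. *)
Fixpoint integral k f : bool :=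
  if k is k'.+1 then
    let hemisphere g := integral k' (prism (set_plus k') vzero g) in
    hemisphere f (+) hemisphere (f \o map antipode)
  else f [::].

(** The prism over a chain above [p] consists of chains above [p] that are one vector longer and use
    one more coordinate. *)
Lemma prism_flag k p f g L : k < n -> signed p -> below k p ->
  (forall M, path vle p M -> all (vector k.+1) M -> size M = (size L).+1 ->
    f M = g M) ->
  path vle p L -> all (vector k) L ->
  prism (set_plus k) p f L = prism (set_plus k) p g L.
Proof.
move=> kn; elim: L p f g => [|x L IH] p f g sp bp fg /=.
  by move=> _ _; apply: fg => //=; rewrite ?vle_set_plus ?set_plus_vector.
case/andP=> px xL /andP[vx vL]; have /and3P[sx _ bx] := vx.
congr (_ (+) _).
  apply: fg => /=; last by rewrite size_map.
    rewrite vle_set_plus set_plus_vle //=.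
    by apply: (homo_path (f := set_plus k)) xL => ? ?; apply: set_plus_vle.
  rewrite !set_plus_vector //= all_map; apply: sub_all vL => y /and3P[sy _ byy].
  exact: set_plus_vector.
apply: IH => // M xM vM sM; apply: fg => /=.
- by rewrite px.
- by rewrite vectorS.
- by rewrite sM.
Qed.

Lemma signed_vzero : signed vzero.
Proof. by rewrite /signed -setI_eq0 setI0. Qed.

Lemma below_vzero k : below k vzero.
Proof. by apply/forall_inP => i; rewrite !inE. Qed.

Lemma prism_vzero_flag k f g L : k < n ->
  (forall M, flag k.+1 M -> f M = g M) -> flag k L ->
  prism (set_plus k) vzero f L = prism (set_plus k) vzero g L.
Proof.
move=> kn fg /and3P[pL vL /eqP sL].
apply: prism_flag pL vL => // [||M pM vM sM]; rewrite ?signed_vzero ?below_vzero //.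
by apply: fg; rewrite /flag pM vM sM sL /=.
Qed.

Lemma flag_antipode k L : flag k (map antipode L) = flag k L.
Proof.
have opp0 : antipode vzero = vzero by [].
rewrite /flag size_map all_map -{1}opp0 path_map.
congr [&& _, _ & _]; last by apply: eq_all => X; apply: vector_antipode.
by apply: eq_path => X Y; apply: vle_antipode.
Qed.

Lemma eq_integral k f g : k <= n ->
  (forall L, flag k L -> f L = g L) -> integral k f = integral k g.
Proof.
elim: k f g => [|k IH] f g kn fg /=; first exact: fg.
congr (_ (+) _); apply: IH (ltnW kn) _ => L fL; apply: prism_vzero_flag => // M fM.
by rewrite /= fg // flag_antipode.
Qed.

Lemma integralD k f g : k <= n ->
  integral k (fun L => f L (+) g L) = integral k f (+) integral k g.
Proof.
elim: k f g => [|k IH] f g kn //=.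
rewrite addbACA; congr (_ (+) _); rewrite -IH ?(ltnW kn) //.
  by apply: eq_integral (ltnW kn) _ => L _; apply: prismD.
by apply: eq_integral (ltnW kn) _ => L _; apply: (prismD _ _ (f \o map antipode)).
Qed.

Lemma integral_antipode k f : k <= n -> integral k (f \o map antipode) = integral k f.
Proof.
case: k => [|k] kn //=; rewrite addbC; congr (_ (+) _).
apply: eq_integral (ltnW kn) _ => L _; apply: eq_prism => M /=.
by rewrite mapK //; apply: antipodeK.
Qed.

(** Stokes for the hemisphere: the second term of [prism_coboundary] is a coboundary, and the
    integral over a cycle kills it. *)
Lemma hemisphere_coboundary k f : k < n ->
  (forall g, integral k (coboundary g) = false) ->
  integral k (prism (set_plus k) vzero (coboundary f)) = integral k f.
Proof.
move=> kn cycle; have kn' := ltnW kn.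
rewrite (eq_integral (g := fun L => f L (+) coboundary (prism (set_plus k) vzero f) L)) //.
  by rewrite integralD // cycle addbF.
by move=> L _; apply: prism_coboundary.
Qed.

(** Both hemispheres have the previous sphere as boundary, which is invariant under the antipode, so
    the two contributions cancel. *)
Lemma integral_coboundary k f : k <= n -> integral k (coboundary f) = false.
Proof.
elim: k f => [|k IH] f kn //=; have kn' := ltnW kn.
rewrite hemisphere_coboundary => // [|g]; last exact: IH.
rewrite -{1}(integral_antipode f kn') -hemisphere_coboundary // => [|g]; last exact: IH.
apply/eqP; rewrite eqbF_neg addbC negb_add; apply/eqP; apply: eq_integral => // L _.
by apply: eq_prism => M /=; rewrite coboundary_map.
Qed.

End SignVectors.

(** * Tucker's lemma *)

(** Neighbours with equal absolute value would be equal labels, hence of equal sign. *)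
Lemma alternating_sorted_half c t :
  {in t &, forall x y, x./2 = y./2 -> x = y} -> sorted leq t ->
  alternating c (map odd t) -> sorted ltn (map half t).
Proof.
elim: t c => [|x [|y t] IH] c // inj /= /andP[xy yt] /and3P[/eqP ox /eqP oy alt_t].
rewrite ltn_neqAle half_leq // andbT; apply/andP; split.
  apply/eqP => /inj; rewrite !inE !eqxx orbT => /(_ isT isT) eq_xy.
  by move: oy; rewrite -eq_xy ox; case: (c).
apply: (IH (~~ c)) => //; last by rewrite /= oy eqxx.
by move=> u v ut vt; apply: inj; rewrite inE (ut, vt) orbT.
Qed.

(* Antipode of a label, in the encoding of [alternating_labels]. *)
Definition flip l := if odd l then l.-1 else l.+1.

Lemma odd_flip l : odd (flip l) = ~~ odd l.
Proof. by rewrite /flip; case: l => [|l] //=; case E: (odd l); rewrite /= E. Qed.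

(** [flip] preserves absolute values, so it could break the order only between two different labels
    with the same one. *)
Lemma sort_flip t : {in t &, forall x y, x./2 = y./2 -> x = y} ->
  sort leq (map flip t) = map flip (sort leq t).
Proof.
move=> inj; have <- : sort leq (map flip (sort leq t)) = map flip (sort leq t).
  apply: (sorted_sort leq_trans); have := sort_sorted leq_total t.
  apply: (homo_sorted_in (P := mem t)) => [x y xt yt xy|]; last first.
    by rewrite all_sort; apply/allP.
  by have := inj x y xt yt; rewrite /flip; do 2 case: ifP; lia.
apply/(perm_sortP leq_total leq_trans anti_leq)/perm_map.
by rewrite perm_sym perm_sort.
Qed.

Section Tucker.
Variable n : nat.
Implicit Types (X Y : svec n).

(** Absolute values start at 0, so the last hypothesis allows [n.-1] of them, one fewer than a flag
    with alternating labels needs. *)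
Theorem octahedral_tucker (abs : svec n -> nat) (sgn : svec n -> bool) :
  0 < n ->
  (forall X, signed X -> nonzero X -> abs (antipode X) = abs X) ->
  (forall X, signed X -> nonzero X -> sgn (antipode X) = ~~ sgn X) ->
  (forall X Y, signed X -> nonzero X -> signed Y -> nonzero Y ->
    vle X Y -> abs X = abs Y -> sgn X = sgn Y) ->
  (forall X, signed X -> nonzero X -> abs X < n.-1) ->
  False.
Proof.
move=> n_gt0 absN sgnN compl_free abs_lt.
pose label X := sgn X + (abs X).*2.
have label_half X : (label X)./2 = abs X by rewrite half_bit_double.
have label_odd X : odd (label X) = sgn X.
  by rewrite oddD odd_double addbF; case: (sgn X).
pose w L := alternating_labels (map label L).
(* Any two vectors of a flag are comparable, so [compl_free] applies to them. *)
have label_inj k L : flag k L ->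
    {in map label L &, forall x y, x./2 = y./2 -> x = y}.
  move=> /and3P[pL vL _] _ _ /mapP[X XL ->] /mapP[Y YL ->].
  rewrite !label_half => eq_abs; rewrite /label eq_abs; congr (_ + _).
  have /and3P[sX nX _] := allP vL _ XL; have /and3P[sY nY _] := allP vL _ YL.
  have [XY|] := boolP (vle X Y); first by rewrite (compl_free X Y).
  have [YX|nYX nXY] := boolP (vle Y X); first by rewrite (compl_free Y X).
  have := path_sorted pL; rewrite (sorted_pairwise (@vle_trans n)).
  move=> /(pairwiseP X) pw.
  move: nXY nYX; rewrite -(nth_index X XL) -(nth_index X YL).
  have [lt|lt|->] := ltngtP (index X L) (index Y L).
  - by rewrite pw // inE index_mem.
  - by rewrite (pw (index Y L)) // inE index_mem.
  - by rewrite /vle !subxx.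
have w_coboundary k L : flag k L -> coboundary w L = w L (+) w (map (@antipode n) L).
  move=> fL; rewrite /w (coboundary_comp label) coboundary_alternating_labels.
  rewrite /alternating_labels -map_comp; congr (_ (+) _).
  have -> : map (label \o @antipode n) L = map flip (map label L).
    rewrite -map_comp; apply/eq_in_map => X XL /=.
    case/and3P: fL => _ /allP/(_ X XL)/and3P[sX nX _] _.
    rewrite /flip label_odd /label absN // sgnN //.
    by case: (sgn X) => /=; lia.
  rewrite (sort_flip (label_inj _ _ fL)) -map_comp (eq_map odd_flip).
  by rewrite (map_comp negb) alternating_negb.
(* The two hemispheres together integrate [w] plus its antipode, that is the coboundary of [w], over
   one hemisphere. By Stokes this is the integral of [w] over the previous sphere. *)
have w1 k : k <= n -> integral k w = true.
  elim: k => [|k IH] kn //=.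
  have kn' := ltnW kn; rewrite -[RHS](IH kn') -(hemisphere_coboundary w kn) => [|g].
    2: exact: integral_coboundary.
  rewrite -integralD //; apply: eq_integral => // L fL.
  rewrite -prismD; apply: prism_vzero_flag kn _ fL => M fM.
  by rewrite (w_coboundary _ _ fM).
suff w0 L : flag n L -> w L = false.
  (* The zero cochain is written as a sum of two equal ones, so additivity gives integral 0. *)
  have := w1 n (leqnn n); rewrite (eq_integral (g := fun L => w L (+) w L)) //.
    by rewrite integralD // addbb.
  by move=> L /w0 ->.
move=> fL; apply/negbTE/negP; rewrite /w /alternating_labels.
set t := sort leq _ => alt_t.
have tP x : (x \in t) = (x \in map label L) by rewrite mem_sort.
have t_inj : {in t &, forall x y, x./2 = y./2 -> x = y}.
  by move=> x y; rewrite !tP; apply: label_inj fL _ _.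
have lt_t := alternating_sorted_half t_inj (sort_sorted leq_total _) alt_t.
have /and3P[_ vL /eqP sL] := fL.
have := @uniq_leq_size _ (map half t) (iota 0 n.-1) (sorted_uniq ltn_trans ltnn lt_t).
rewrite size_map size_sort size_map sL size_iota.
suff sub : {subset map half t <= iota 0 n.-1}.
  by move=> /(_ sub); case: (n) n_gt0 => // m _; rewrite ltnn.
move=> _ /mapP[l /[!tP]/mapP[X XL ->] ->]; rewrite label_half mem_iota /=.
by have /and3P[sX nX _] := allP vL _ XL; apply: abs_lt.
Qed.
End Tucker.

(** * Alternating pairs *)

Section Alternation.
Variable n : nat.
Implicit Types (X Y : svec n) (l u : seq 'I_n).

Definition side c X := if c then X.1 else X.2.

Lemma side_antipode c X : side c (antipode X) = side (~~ c) X.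
Proof. by case: c. Qed.

Lemma side_signed c X i : signed X -> i \in side c X -> i \notin side (~~ c) X.
Proof.
rewrite /signed => dX; case: c => /= iX; first by rewrite (disjointFr dX).
by rewrite (disjointFl dX).
Qed.

Lemma vle_side c X Y : vle X Y -> side c X \subset side c Y.
Proof. by case/andP; case: c. Qed.

Fixpoint altseq c X u : bool :=
  if u is i :: u' then (i \in side c X) && altseq (~~ c) X u' else true.

(* The greedy choice is a longest alternating subsequence starting with sign [c]. *)
Fixpoint altsub c X l : seq 'I_n :=
  if l is i :: l' then
    if i \in side c X then i :: altsub (~~ c) X l' else altsub c X l'
  else [::].

Lemma altsub_antipode c X l : altsub c (antipode X) l = altsub (~~ c) X l.
Proof. by elim: l c => //= i l IH c; rewrite side_antipode !IH. Qed.

Lemma altseq_altsub c X l : altseq c X (altsub c X l).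
Proof. by elim: l c => //= i l IH c; case: ifP => //= ->; apply: IH. Qed.

Lemma altsub_subseq c X l : subseq (altsub c X l) l.
Proof.
elim: l c => [|i l IH] c //=; case: ifP => _; first by rewrite /= eqxx.
exact: subseq_trans (IH c) (subseq_cons _ _).
Qed.

Lemma altseq_take m c X u : altseq c X u -> altseq c X (take m u).
Proof. by elim: u m c => [|i u IH] [|m] c //= /andP[-> alt_u]; apply: IH. Qed.

(** Without its first entry, an alternating subsequence starts with the other sign. *)
Lemma size_altsub_negb c X l : size (altsub c X l) <= (size (altsub (~~ c) X l)).+1.
Proof.
elim: l c => //= i l IH c; rewrite negbK.
by have := IH c; have := IH (~~ c); rewrite negbK; do 2 case: ifP => //= _; lia.
Qed.

(** The sign of the first nonzero entry decides: starting with it gains exactly one entry. *)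
Lemma size_altsub_neq c X l : signed X -> has (mem (X.1 :|: X.2)) l ->
  size (altsub c X l) != size (altsub (~~ c) X l).
Proof.
move=> sX; elim: l c => //= i l IH c; rewrite negbK.
have [ic|inc] := boolP (i \in side c X).
  by rewrite (negbTE (side_signed sX ic)) /= eqn_leq ltnn.
have [ic|inc'] := boolP (i \in side (~~ c) X).
  by rewrite /= eqn_leq ltnn andbF.
have -> : i \in X.1 :|: X.2 = false.
  by rewrite inE; apply/norP; move: inc inc'; case: (c).
exact: IH.
Qed.

(** What alternates for [X] alternates for [Y]. If only [Y] picks an entry, that entry makes up for
    the one that [size_altsub_negb] may lose. *)
Lemma size_altsub_vle c X Y l : vle X Y ->
  size (altsub c X l) <= size (altsub c Y l).
Proof.
move=> XY; elim: l c => //= i l IH c.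
have := subsetP (vle_side c XY) i; case: ifP => [_ -> //|_ _]; first by rewrite ltnS IH.
case: ifP => _ //=.
exact: leq_trans (IH c) (size_altsub_negb _ _ _).
Qed.

Lemma altseq_count c X u : signed X -> altseq c X u ->
  let a := count (mem (side c X)) u in let b := count (mem (side (~~ c) X)) u in
  [/\ a + b = size u, b <= a & a <= b.+1].
Proof.
move=> sX; elim: u c => [|i u IH] c //= /andP[ic /IH]; rewrite negbK.
by rewrite ic (negbTE (side_signed sX ic)) /=; case; split; lia.
Qed.

(** Between two entries of the same sign lies one of the other sign. *)
Lemma altseq_gap c d X u (i j : 'I_n) : signed X -> altseq c X u ->
  sorted (fun x y : 'I_n => x < y) u -> i \in u -> j \in u ->
  i \in side d X -> j \in side d X -> i < j -> i.+1 < j.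
Proof.
move=> sX; elim: u c => [|x u IH] c //= /andP[xc alt_u] xu iu ju id jd ij.
have u_sorted := path_sorted xu.
have x_lt y : y \in u -> x < y.
  move=> yu; have := order_path_min _ xu => /(_ _)/allP; apply=> //.
  by move=> ? ? ?; apply: ltn_trans.
move: iu ju; rewrite !inE => /orP[/eqP ix|iu] /orP[/eqP jx|ju].
- by move: ij; rewrite ix jx ltnn.
- case: u alt_u xu u_sorted x_lt ju {IH} => //= h u /andP[hc _] /andP[xh _] hu _.
  rewrite inE => /orP[/eqP jh|ju].
    move: (side_signed sX xc) (side_signed sX hc) id jd; rewrite ix jh negbK.
    have [->|dc] := eqVneq d c; first by move=> _ /negP hN _ /hN.
    have -> : d = ~~ c by move: dc; case: (c); case: (d).
    by move=> /negP xN _ /xN.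
  have h_lt : h < j.
    have := order_path_min _ hu => /(_ _)/allP; apply=> //.
    by move=> ? ? ?; apply: ltn_trans.
  by rewrite ix; lia.
- by move: (x_lt i iu) ij; rewrite jx; lia.
- exact: (IH (~~ c)).
Qed.

(** The first [m] entries of the alternating subsequence are split by sign. *)
Lemma altsub_split c X m : signed X -> m <= size (altsub c X (enum 'I_n)) ->
  exists A B : {set 'I_n}, [/\ A \subset X.1, B \subset X.2,
    almost_stable 2 A /\ almost_stable 2 B, #|A| + #|B| = m &
    #|A| <= #|B|.+1 /\ #|B| <= #|A|.+1].
Proof.
move=> sX mle; pose u := take m (altsub c X (enum 'I_n)).
have u_alt : altseq c X u by apply/altseq_take/altseq_altsub.
have u_sorted : sorted (fun x y : 'I_n => x < y) u.
  have u_sub : subseq u (enum 'I_n).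
    exact: subseq_trans (take_subseq _ _) (altsub_subseq _ _ _).
  apply: subseq_sorted u_sub _; first by move=> ? ? ?; apply: ltn_trans.
  by have := iota_ltn_sorted 0 n; rewrite -val_enum_ord sorted_map.
have u_uniq : uniq u.
  apply: sorted_uniq u_sorted; first by move=> ? ? ?; apply: ltn_trans.
  by move=> ?; apply: ltnn.
pose N d := [set i in filter (mem (side d X)) u].
have cardN d : #|N d| = count (mem (side d X)) u.
  by rewrite cardsE (card_uniqP _) ?filter_uniq // size_filter.
have stableN d : almost_stable 2 (N d).
  apply/forall_inP => i; rewrite inE mem_filter => /andP[id iu].
  apply/forall_inP => j; rewrite inE mem_filter => /andP[jd ju].
  apply/implyP => neq_ij; have gap := altseq_gap sX u_alt u_sorted.
  have := gap d i j iu ju id jd; have := gap d j i ju iu jd id.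
  by rewrite -val_eqE /= in neq_ij; lia.
have subN d : N d \subset side d X.
  by apply/subsetP => i; rewrite inE mem_filter => /andP[].
have [] := altseq_count sX u_alt; rewrite -!cardN size_takel // => eq_m ge le.
exists (N true), (N false); split; [exact: (subN true)|exact: (subN false)|by []| |].
  by rewrite -eq_m; case: (c) => //; rewrite addnC.
by move: ge le; case: (c) => /=; lia.
Qed.

End Alternation.

(** * Tucker's lemma for the Kneser labeling *)

Section KneserTucker.
Variables (n t : nat) (G : {set {set 'I_n}}) (col : {set 'I_n} -> nat).
Implicit Types (X Y : svec n).

Theorem alternating_avoiding_pair :
  set0 \notin G ->
  (forall A, A \in G -> col A < t) ->
  (forall A B, A \in G -> B \in G -> [disjoint A & B] -> col A != col B) ->
  exists A B : {set 'I_n}, [/\ [disjoint A & B],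
    almost_stable 2 A /\ almost_stable 2 B, A \notin G /\ B \notin G,
    #|A| + #|B| = n - t & #|A| <= #|B|.+1 /\ #|B| <= #|A|.+1].
Proof.
move=> G0 col_lt col_neq.
have [nt|tn] := leqP n t.
  (* Here [n - t] is 0. *)
  exists set0, set0; rewrite -setI_eq0 setI0 eqxx cards0 G0; split=> //; last by lia.
  by split; apply/forall_inP => i; rewrite inE.
pose good (p : {set 'I_n} * {set 'I_n}) :=
  [&& [disjoint p.1 & p.2], almost_stable 2 p.1, almost_stable 2 p.2,
    p.1 \notin G, p.2 \notin G, #|p.1| + #|p.2| == n - t,
    #|p.1| <= #|p.2|.+1 & #|p.2| <= #|p.1|.+1].
have [/existsP[[A B]]|/existsPn noPair] := boolP [exists p, good p].
  case/and5P=> /= d sA sB AG /and4P[BG /eqP eq_nt le1 le2].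
  by exists A, B.
exfalso.
pose hit X := [exists A in G, (A \subset X.1) || (A \subset X.2)].
(* Each sign gets a score [P]. Colors are raised by 1 so that [M] is 0 exactly on a side without
   members of [G], and the shift by [(n - t).-1] puts the scores of hit vectors above the
   alternation numbers of the others (see [unhit]). *)
pose M c X := \max_(A in G | A \subset side c X) (col A).+1.
pose P c X := if hit X then M c X + (n - t).-1 else size (altsub c X (enum 'I_n)).
have hitP X : reflect (exists c A, A \in G /\ A \subset side c X) (hit X).
  apply: (iffP exists_inP) => [[A AG /orP[]]|[[] [A [AG AX]]]].
  - by exists true, A.
  - by exists false, A.
  - by exists A => //; apply/orP; left.
  - by exists A => //; apply/orP; right.
have hitN X : hit (antipode X) = hit X.
  by apply/eq_existsb => A; rewrite orbC.
have hit_vle X Y : vle X Y -> hit X -> hit Y.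
  move=> XY /hitP[c [A [AG AX]]]; apply/hitP; exists c, A; split=> //.
  exact: subset_trans AX (vle_side c XY).
(* A longer alternating subsequence would split into a pair as in the conclusion. *)
have unhit X c : signed X -> ~~ hit X -> size (altsub c X (enum 'I_n)) <= (n - t).-1.
  move=> sX; apply: contraR; rewrite -ltnNge => lt_size.
  have [|A [B [AX BX [sA sB] card_AB [le1 le2]]]] := @altsub_split n c X (n - t) sX.
    by lia.
  have := noPair (A, B); rewrite /good /= sA sB card_AB eqxx le1 le2 !andbT /=.
  have -> /= : [disjoint A & B] by apply: disjointWl AX (disjointWr BX sX).
  rewrite negb_and !negbK => /orP[AG|BG]; apply/hitP.
    by exists true, A.
  by exists false, B.
have M_le c X : M c X <= t by apply/bigmax_leqP => A /andP[/col_lt].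
have M_attained c X : 0 < M c X ->
    exists A, [/\ A \in G, A \subset side c X & M c X = (col A).+1].
  rewrite /M; elim/big_rec: _ => // A m /andP[AG AX] IH _.
  by have [_|lt_m] := leqP m (col A).+1; [exists A | apply: IH; lia].
have M_hit c X A : A \in G -> A \subset side c X -> 0 < M c X.
  by move=> AG AX; rewrite /M (bigD1 A) ?AG //= leq_max.
have P_antipode c X : P c (antipode X) = P (~~ c) X.
  by rewrite /P hitN altsub_antipode /M side_antipode.
have P_vle c X Y : signed X -> vle X Y -> P c X <= P c Y.
  move=> sX XY; rewrite /P; have [hX|nX] := boolP (hit X).
    rewrite (hit_vle _ _ XY hX) leq_add2r.
    apply/bigmax_leqP => A /andP[AG AX]; apply: leq_bigmax_cond.
    by rewrite AG (subset_trans AX (vle_side c XY)).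
  case: ifP => _; last exact: size_altsub_vle.
  by apply: leq_trans (unhit _ _ sX nX) (leq_addl _ _).
have P_neq X : signed X -> nonzero X -> P true X != P false X.
  move=> sX /set0Pn[i iX]; rewrite /P; case: ifP => [/hitP[c [A [AG AX]]]|_].
    rewrite eqn_add2r; apply/negP => /eqP eqM.
    have := M_hit _ _ _ AG AX.
    have -> : M c X = M true X by case: (c).
    (* Equal maxima are attained on both sides, hence by disjoint members of [G] with the same
       color. *)
    move=> M_gt0; have [B [BG BX eqB]] := M_attained _ _ M_gt0.
    have [|C [CG CX eqC]] := M_attained false X; first by rewrite -eqM.
    have := col_neq B C BG CG; rewrite (disjointWl BX (disjointWr CX sX)) => /(_ isT).
    by move: eqM; rewrite eqB eqC => -[->]; rewrite eqxx.
  apply: (size_altsub_neq true sX); apply/hasP; exists i => //.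
  exact: mem_enum.
have P_lt c X : signed X -> P c X < n.
  move=> sX; rewrite /P; case: ifP => [_|/negbT nX]; first by have := M_le c X; lia.
  by have := unhit X c sX nX; lia.
(* The two scores are distinct and below [n], so the larger one lies between 1 and [n.-1]. Scores
   grow along [vle], so a larger score that keeps its value also keeps its side. *)
apply: (@octahedral_tucker n (fun X => (maxn (P true X) (P false X)).-1)
  (fun X => P false X < P true X)).
- by lia.
- by move=> X _ _; rewrite !P_antipode maxnC.
- move=> X sX nX; rewrite !P_antipode /=.
  by have := P_neq X sX nX; lia.
- move=> X Y sX nX sY nY XY.
  have := P_neq X sX nX; have := P_neq Y sY nY.
  by have := P_vle true X Y sX XY; have := P_vle false X Y sX XY; lia.
- move=> X sX nX.
  by have := P_neq X sX nX; have := P_lt true X sX; have := P_lt false X sX; lia.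
Qed.

End KneserTucker.

(** * Equipartitions *)

Definition mono_packing n (r s : nat) (F : {set {set 'I_n}})
    (col : {set 'I_n} -> nat) (E : {set {set 'I_n}}) : bool :=
  [&& #|E| == r, E \subset stable_part s F,
    [forall A in E, forall B in E, (A != B) ==> [disjoint A & B]] &
    [forall A in E, forall B in E, col A == col B]].

Lemma mono_packingP n r s (F : {set {set 'I_n}}) (col : {set 'I_n} -> nat)
    (E : {set {set 'I_n}}) :
  reflect [/\ #|E| = r, {subset E <= stable_part s F},
    {in E &, forall A B : {set 'I_n}, A != B -> [disjoint A & B]} &
    {in E &, forall A B, col A = col B}] (mono_packing r s F col E).
Proof.
apply: (iffP and4P) => [[/eqP cE /subsetP sE /forall_inP dE /forall_inP mE]|[cE sE dE mE]].
  split=> // A B AE BE.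
    by move=> AB; have /forall_inP/(_ B BE)/implyP := dE A AE; apply.
  by have /forall_inP/(_ B BE)/eqP := mE A AE.
split; [exact/eqP|exact/subsetP| |]; apply/forall_inP => A AE; apply/forall_inP => B BE.
  by apply/implyP; apply: dE.
exact/eqP/mE.
Qed.

(* A coloring of the points of [N] by the classes [0, ..., q-1]: colors [>= q]
   stand for removed points, and exactly [d] points of [N] are removed, or all of
   them. The two inequalities confine the class sizes to the floor and the
   ceiling of (#|N| - d) / q. *)
Definition equipartition n q d (F : {set {set 'I_n}}) (N : {set 'I_n}) (h : 'I_n -> nat) :=
  #|[set x in N | h x < q]| = #|N| - d /\
  forall i, i < q -> let X := [set x in N | h x == i] in
    [/\ #|X| * q < #|N| - d + q, #|N| - d < #|X| * q + q &
      forall A, A \in F -> ~~ (A \subset X)].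

(** This is P(r, s), for all ground sets at once, since the induction passes to subsets. *)
Definition packing_bound r s := forall n t (F : {set {set 'I_n}}) col,
  set0 \notin F -> (forall A, A \in stable_part s F -> col A < t) ->
  (forall E, ~~ mono_packing r s F col E) ->
  exists h, equipartition s (t * r.-1) F [set: 'I_n] h.

(** The right side is the ceiling of $(n-j)/m$; adding [m.-1] first avoids truncation. *)
Lemma card_residue_class n m j : j < m ->
  #|[set x : 'I_n | x %% m == j]| = (n + m.-1 - j) %/ m.
Proof.
move=> jm; rewrite -sum1dep_card big_mkcond /=.
elim: n => [|n IH]; first by rewrite big_ord0 divn_small //; lia.
rewrite big_ord_recr /= IH.
have -> : n.+1 + m.-1 - j = (n + m.-1 - j).+1 by lia.
rewrite divnS; last by lia.
rewrite addnC; congr (_ + _).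
have -> : (n + m.-1 - j).+1 = n + m - j by lia.
have -> : (m %| n + m - j) = (n %% m == j); last by case: ifP.
rewrite -addnBA ?(ltnW jm) // /dvdn -modnDml.
apply/idP/eqP => [|->]; last by rewrite subnKC ?modnn // ltnW.
have lt_m := ltn_pmod n (leq_ltn_trans (leq0n j) jm).
case: (ltngtP (n %% m) j) => // lt_j.
  by rewrite modn_small; lia.
have -> : n %% m + (m - j) = (n %% m - j) + m by lia.
by rewrite modnDr modn_small; lia.
Qed.

Lemma almost_stable_residue n m (A : {set 'I_n}) j : 0 < m ->
  A \subset [set x : 'I_n | x %% m == j] -> almost_stable m A.
Proof.
move=> m0 /subsetP sA; apply/forall_inP => x /sA; rewrite inE => /eqP xj.
apply/forall_inP => y /sA; rewrite inE => /eqP yj; apply/implyP; rewrite -val_eqE /=.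
have [lt_xy|lt_yx|->] := ltngtP (x : nat) y; rewrite ?eqxx // => _.
  by rewrite distnEr ?(ltnW lt_xy) // dvdn_leq ?subn_gt0 // -eqn_mod_dvd ?xj ?yj // ltnW.
by rewrite distnEl ?(ltnW lt_yx) // dvdn_leq ?subn_gt0 // -eqn_mod_dvd ?xj ?yj // ltnW.
Qed.

(** A member of [F] inside a residue class is [m]-stable, and for [r] = 1 it alone forms a
    monochromatic packing. *)
Lemma packing_bound1 m : 0 < m -> packing_bound 1 m.
Proof.
move=> m_gt0 n t F col F0 _ noE; exists (fun x => x %% m).
have lt_m (x : 'I_n) : x %% m < m by rewrite ltn_mod.
rewrite /equipartition muln0 subn0 cardsT card_ord; split.
  rewrite -[RHS](card_ord n) -cardsT; congr #|pred_of_set _|.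
  by apply/setP => x; rewrite !inE lt_m.
move=> i im; have -> : [set x in [set: 'I_n] | x %% m == i] = [set x : 'I_n | x %% m == i].
  by apply/setP => x; rewrite !inE.
rewrite /= card_residue_class //; split.
- have := leq_trunc_div (n + m.-1 - i) m; lia.
- have := ltn_ceil (n + m.-1 - i) m_gt0; rewrite mulSn; lia.
move=> A AF; apply/negP => /(almost_stable_residue m_gt0) stA.
have /mono_packingP[] := noE [set A]; split.
- exact: cards1.
- by move=> B /set1P->; rewrite inE AF.
- by move=> B C /set1P-> /set1P->; rewrite eqxx.
- by move=> B C /set1P-> /set1P->.
Qed.

(** * Restriction to a 2-stable subset of the ground set *)

Section Restriction.
Variables (n : nat) (N : {set 'I_n}).
Let f : 'I_#|N| -> 'I_n := enum_val.

Lemma enum_val_lt (y z : 'I_#|N|) : y < z -> f y < f z.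
Proof.
move=> yz; have yN := ltn_ord y; have zN := ltn_ord z.
have N_sorted : sorted (fun i j : 'I_n => i < j) (enum N).
  have trans : transitive (fun i j : 'I_n => i < j) by move=> ? ? ?; apply: ltn_trans.
  apply: (subseq_sorted trans (s2 := enum 'I_n)).
    by rewrite [enum 'I_n]enumT; apply: filter_subseq.
  by have := iota_ltn_sorted 0 n; rewrite -val_enum_ord sorted_map.
rewrite /f !(enum_val_nth (f y)).
apply: (sorted_ltn_nth _ _ N_sorted); rewrite ?inE -?cardE // => ? ? ?.
exact: ltn_trans.
Qed.

(** Consecutive elements of [N] are at least 2 apart, and these gaps add up. *)
Lemma enum_val_gap (y z : 'I_#|N|) : almost_stable 2 N -> y <= z ->
  f y + 2 * (z - y) <= f z.
Proof.
move=> stN; have [k] := ubnP (z - y); elim: k z => // k IH z zk yz.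
have [->|] := eqVneq y z; first by rewrite subnn muln0 addn0.
rewrite -val_eqE /= => neq_yz; have lt_yz : y < z by rewrite ltn_neqAle neq_yz.
have z1N : z.-1 < #|N| by have := ltn_ord z; lia.
pose z1 := Ordinal z1N.
have lt_f : f z1 < f z by apply: enum_val_lt; rewrite /= ltn_predL; case: (z : nat) lt_yz.
have := forall_inP (forall_inP stN _ (enum_valP z)) _ (enum_valP z1).
rewrite -/(f z) -/(f z1) -val_eqE /= gtn_eqF // distnEl ?(ltnW lt_f) //=.
have := IH z1; rewrite /=; move: (f y : nat) (f z : nat) (f z1 : nat) lt_f => a b c.
  by move: (nat_of_ord z) (nat_of_ord y) lt_yz zk => u v; clear; lia.
Qed.

Lemma almost_stable_enum_val s (A : {set 'I_#|N|}) :
  almost_stable 2 N -> almost_stable s A -> almost_stable (2 * s) (f @: A).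
Proof.
move=> stN stA; apply/forall_inP => _ /imsetP[y yA ->].
apply/forall_inP => _ /imsetP[z zA ->]; apply/implyP => neq.
have := forall_inP (forall_inP stA y yA) z zA; rewrite -(inj_eq (@enum_val_inj _ N)) neq /=.
have := @enum_val_gap y z stN; have := @enum_val_gap z y stN.
have [le_yz|/ltnW le_zy] := leqP y z.
  move=> _ /(_ isT) gap; have le_f := leq_trans (leq_addr _ _) gap.
  rewrite (distnEr le_yz) (distnEr le_f) (leq_subRL _ le_f) => h.
  by apply: leq_trans gap; rewrite leq_add2l leq_mul2l h orbT.
move=> /(_ le_zy) gap _; have le_f := leq_trans (leq_addr _ _) gap.
rewrite (distnEl le_zy) (distnEl le_f) (leq_subRL _ le_f) => h.
by apply: leq_trans gap; rewrite leq_add2l leq_mul2l h orbT.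
Qed.

(** P(r, s) is applied to the order-preserving copy of [N], where packings map to packings inside
    [N]. *)
Lemma packing_bound_sub r s t (F : {set {set 'I_n}}) col :
  packing_bound r s -> almost_stable 2 N -> set0 \notin F ->
  (forall A, A \in stable_part (2 * s) F -> col A < t) ->
  (forall E, mono_packing r (2 * s) F col E -> ~~ [forall A in E, A \subset N]) ->
  exists h, equipartition s (t * r.-1) F N h.
Proof.
move=> bound stN F0 col_lt noE.
have f_inj : injective f by apply: enum_val_inj.
have fN y : f y \in N by apply: enum_valP.
pose F' := [set A : {set 'I_#|N|} | f @: A \in F].
have f_stable (A : {set 'I_#|N|}) : A \in stable_part s F' ->
    f @: A \in stable_part (2 * s) F.
  by rewrite !inE => /andP[-> stA]; apply: almost_stable_enum_val.
have [|A AF|E|h' [card_h' class_h']] := bound _ t F' (fun A => col (f @: A)).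
- by rewrite inE imset0.
- exact/col_lt/f_stable.
- apply/negP => /mono_packingP[cE sE dE mE].
  suff /noE/negP[] : mono_packing r (2 * s) F col [set f @: (A : {set _}) | A in E].
    by apply/forall_inP => _ /imsetP[A _ ->]; apply/subsetP => _ /imsetP[y _ ->].
  apply/mono_packingP; split.
  + by rewrite card_imset //; apply: imset_inj.
  + by move=> _ /imsetP[A AE ->]; apply/f_stable/sE.
  + move=> _ _ /imsetP[A AE ->] /imsetP[B BE ->].
      rewrite (inj_eq (imset_inj f_inj)) imset_disjoint //.
      exact: dE.
  + by move=> _ _ /imsetP[A AE ->] /imsetP[B BE ->]; apply: mE.
(* The default 0 is taken only outside [N], where [equipartition] does not look. *)
pose h x := if [pick y | f y == x] is Some y then h' y else 0.
have hf y : h (f y) = h' y.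
  by rewrite /h; case: pickP => [z /eqP/f_inj-> //|/(_ y)]; rewrite eqxx.
have setN (P : pred nat) : [set x in N | P (h x)] = f @: [set y in [set: _] | P (h' y)].
  apply/setP => x; apply/idP/imsetP => [|[y]]; rewrite !inE => /=.
    case/andP => xN Px; exists (enum_rank_in xN x); rewrite ?inE /=.
      by rewrite -hf /f enum_rankK_in.
    by rewrite /f enum_rankK_in.
  by move=> Py ->; rewrite fN hf.
exists h; split.
  by rewrite (setN (fun k => k < s)) card_imset // card_h' cardsT card_ord.
move=> i /class_h'[]; rewrite cardsT card_ord => le1 le2 sub.
rewrite /= (setN (fun k => k == i)) card_imset //; split=> // A AF.
apply/negP => AX; have := sub (f @^-1: A).
have -> : f @^-1: A \in F'.
  rewrite inE; suff -> : f @: (f @^-1: A) = A by [].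
  apply/setP => x; apply/imsetP/idP => [[y]|xA]; first by rewrite inE => ? ->.
  by have /imsetP[y _ xy] := subsetP AX x xA; exists y => //; rewrite inE -xy.
move=> /(_ isT)/negP; apply; apply/subsetP => y yA.
have fyA : f y \in A by move: yA; rewrite inE.
by have := subsetP AX _ fyA; rewrite mem_imset // !inE.
Qed.

End Restriction.

Lemma equipartition_join n s t d (F : {set {set 'I_n}}) (A B : {set 'I_n}) hA hB :
  [disjoint A & B] -> #|A| + #|B| = n - t ->
  #|A| <= #|B|.+1 -> #|B| <= #|A|.+1 ->
  equipartition s d F A hA -> equipartition s d F B hB ->
  exists h, equipartition (2 * s) (t + 2 * d) F [set: 'I_n] h.
Proof.
move=> dAB cAB leAB leBA [cA partA] [cB partB].
(* The classes of [B] are renumbered from [s] on, and [2 * s] marks removed points. *)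
pose h x := if (x \in A) && (hA x < s) then hA x
            else if (x \in B) && (hB x < s) then s + hB x else 2 * s.
have notAB x : x \in A -> x \in B = false by apply: disjointFr.
have keepE : [set x in [set: 'I_n] | h x < 2 * s] =
    [set x in A | hA x < s] :|: [set x in B | hB x < s].
  apply/setP => x; rewrite !inE /h; case: ifP => [/andP[_ A_lt]|_] /=; first by lia.
  by case: ifP => [/andP[_ B_lt]|_]; lia.
have classA i : i < s -> [set x in [set: 'I_n] | h x == i] = [set x in A | hA x == i].
  move=> i_lt; apply/setP => x; rewrite !inE /h; case: ifP => [/andP[-> _] //|notA].
  have -> : (x \in A) && (hA x == i) = false.
    by apply/negP => /andP[xA /eqP hi]; rewrite xA hi i_lt in notA.
  by case: ifP => _; lia.
have classB i : i < s ->
    [set x in [set: 'I_n] | h x == s + i] = [set x in B | hB x == i].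
  move=> i_lt; apply/setP => x; rewrite !inE /h; case: ifP => [/andP[xA A_lt]|_].
    by rewrite (notAB _ xA); lia.
  case: ifP => [/andP[-> _]|notB]; first by rewrite eqn_add2l.
  have -> : (x \in B) && (hB x == i) = false; last by lia.
  by apply/negP => /andP[xB /eqP hi]; rewrite xB hi i_lt in notB.
(* Truncation does no harm: the sizes differ by at most 1, so both are at least [d] or both at most
   [d]. *)
have card_eq : #|[set: 'I_n]| - (t + 2 * d) = (#|A| - d) + (#|B| - d).
  by rewrite cardsT card_ord; lia.
exists h; split.
  rewrite keepE cardsU cA cB card_eq.
  suff -> : [set x in A | hA x < s] :&: [set x in B | hB x < s] = set0.
    by rewrite cards0 subn0.
  apply/setP => x; rewrite !inE; case xA: (x \in A) => //=.
  by rewrite (notAB x xA) andbF.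
(* Doubling a strict inequality between integers yields slack 2, which absorbs the difference of at
   most 1 between [a] and [b]. *)
have class_size c a b : c * s < a - d + s -> a - d < c * s + s ->
    a <= b.+1 -> b <= a.+1 ->
    c * (2 * s) < a - d + (b - d) + 2 * s /\ a - d + (b - d) < c * (2 * s) + 2 * s.
  by rewrite mulnCA; lia.
move=> i i_lt; rewrite card_eq /=; have [i_s|s_i] := ltnP i s.
  have [le1 le2 noF] := partA i i_s; rewrite classA //.
  by have [] := class_size _ _ _ le1 le2 leAB leBA.
have i_s : i - s < s by rewrite ltn_subLR // addnn -mul2n.
have [le1 le2 noF] := partB _ i_s; rewrite -(subnKC s_i) classB //.
by rewrite [_ - d + _]addnC; have [] := class_size _ _ _ le1 le2 leBA leAB.
Qed.

Lemma packing_bound_double r s :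
  0 < r -> packing_bound r s -> packing_bound (2 * r) (2 * s).
Proof.
move=> r0 bound n t F col F0 col_lt noE.
pose inside (N : {set 'I_n}) (E : {set {set 'I_n}}) :=
  mono_packing r (2 * s) F col E && [forall A in E, A \subset N].
pose G := [set N | [exists E, inside N E]].
pose colG N := if [pick E | inside N E] is Some E then
  if [pick A in E] is Some A then col A else 0 else 0.
have colGP N : N \in G -> exists E, [/\ mono_packing r (2 * s) F col E,
    forall A : {set 'I_n}, A \in E -> A \subset N, forall A, A \in E -> colG N = col A &
    exists A, A \in E].
  rewrite inE /colG; case: pickP => [E /andP[mE /forall_inP EN] _|none].
    2: by move=> /existsP[E]; rewrite none.
  have /mono_packingP[cE _ _ colE] := mE; exists E; split=> //.
    by move=> A AE; case: pickP => [B BE|/(_ A)]; [exact: colE | rewrite AE].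
  by apply/set0Pn; rewrite -card_gt0 cE.
have [||N1 N2 N1G N2G dN|A [B [dAB [stA stB] [AG BG] cAB [leAB leBA]]]] :=
  @alternating_avoiding_pair n t G colG.
- apply/negP => /colGP[E [/mono_packingP[_ sE _ _] EN _ [A AE]]].
  have := sE _ AE; rewrite inE => /andP[AF _].
  by have := EN A AE; rewrite subset0 => /eqP A0; rewrite -A0 AF in F0.
- move=> N /colGP[E [/mono_packingP[_ sE _ _] _ colE [A AE]]].
  by rewrite (colE A AE); apply/col_lt/sE.
- have [E1 [/mono_packingP[c1 s1 d1 m1] in1 col1 [A1 A1E]]] := colGP _ N1G.
  have [E2 [/mono_packingP[c2 s2 d2 m2] in2 col2 [A2 A2E]]] := colGP _ N2G.
  (* Two packings of the same color inside disjoint sets merge into one of size [2 * r]; a common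
     member would be disjoint from itself, hence empty. *)
  apply/eqP => eq_col; have /negP := noE (E1 :|: E2); apply; apply/mono_packingP.
  have d12 (X Y : {set 'I_n}) : X \in E1 -> Y \in E2 -> [disjoint X & Y].
    by move=> /in1 XN /in2 YN; apply: disjointWl XN (disjointWr YN dN).
  have m12 X Y : X \in E1 -> Y \in E2 -> col X = col Y.
    by move=> /col1 <- /col2 <-.
  split.
  + rewrite cardsU c1 c2; suff -> : E1 :&: E2 = set0 by rewrite cards0; lia.
    apply/setP => X; rewrite !inE; apply/negP => /andP[X1 X2].
    have := d12 X X X1 X2; rewrite -setI_eq0 setIid => /eqP X0.
    by have := s1 _ X1; rewrite inE X0 (negbTE F0).
  + by move=> X; rewrite inE => /orP[/s1|/s2].
  + move=> X Y; rewrite !inE => /orP[X1|X2] /orP[Y1|Y2] neq.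
    * exact: d1. * exact: d12. * by rewrite disjoint_sym; apply: d12. * exact: d2.
  + move=> X Y; rewrite !inE => /orP[X1|X2] /orP[Y1|Y2].
    * exact: m1. * exact: m12. * by apply/esym/m12. * exact: m2.
have sub N : almost_stable 2 N -> N \notin G ->
    exists h, equipartition s (t * r.-1) F N h.
  move=> stN NG; apply: packing_bound_sub bound stN F0 col_lt _ => E mE.
  by apply: contra NG => EN; rewrite inE; apply/existsP; exists E; rewrite /inside mE.
have [hA partA] := sub A stA AG; have [hB partB] := sub B stB BG.
(* The pair [A], [B] misses [t] points, and each half loses at most [t * r.-1] more. *)
have -> : t * (2 * r).-1 = t + 2 * (t * r.-1).
  by case: (r) r0 => // r' _; rewrite mulnS /=; lia.
exact: equipartition_join dAB cAB leAB leBA partA partB.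
Qed.

Lemma packing_bound_pow2 a m : 0 < m -> packing_bound (2 ^ a) (2 ^ a * m).
Proof.
move=> m0; elim: a => [|a IH]; first by rewrite mul1n; apply: packing_bound1.
by rewrite expnS -mulnA; apply: packing_bound_double; rewrite ?expn_gt0.
Qed.

Lemma equipartition_ecd n q d (F : {set {set 'I_n}}) h :
  set0 \notin F -> equipartition q d F [set: 'I_n] h -> ecd q F <= d.
Proof.
move=> F0 [cF part]; have [_ /(_ [set x | q <= h x])] := ecdP q F0.
(* This is the minimum of [n] and [d]. *)
have -> : #|[set x | q <= h x]| = n - (n - d).
  rewrite cardsT card_ord in cF; rewrite -cF.
  have <- : ~: [set x in [set: 'I_n] | h x < q] = [set x | q <= h x].
    by apply/setP => x; rewrite !inE -leqNgt.
  by rewrite cardsCs setCK card_ord.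
move=> le_ecd; apply: (leq_trans (le_ecd _)); last by lia.
pose X := [ffun i : 'I_q => [set x in [set: 'I_n] | h x == i]].
apply/existsP; exists X; apply/andP; split; last first.
  apply/forallP => i; apply/forall_inP => A AF; rewrite ffunE.
  by have [_ _] := part i (ltn_ord i); apply.
apply/and3P; split.
- apply/eqP/setP => x; rewrite !inE -ltnNge; apply/bigcupP/idP => [[i _]|hx].
    by rewrite ffunE !inE => /eqP->.
  by exists (Ordinal hx); rewrite // ffunE !inE /=.
- apply/forallP => i; apply/forallP => j; apply/implyP => neq.
  rewrite -setI_eq0; apply/eqP/setP => x; rewrite !ffunE !inE.
  by apply/negP => /andP[/eqP-> /eqP/val_inj eq_ij]; rewrite eq_ij eqxx in neq.
- apply/forallP => i; apply/forallP => j; rewrite !ffunE.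
  have [le1 lt1 _] := part i (ltn_ord i); have [le2 lt2 _] := part j (ltn_ord j).
  move: le1 lt1 le2 lt2; set a := #|[set x in _ | _ == val i]|.
  set b := #|[set x in _ | _ == val j]|; move: a b (_ - d) => a b T.
  (* Chaining the bounds gives [a * q < T + q < b * q + 2 * q], and likewise with [a] and [b]
     exchanged. *)
  move=> le1 lt1 le2 lt2; have [le_ab le_ba] : a <= b.+1 /\ b <= a.+1 by nia.
  by have [ab|/ltnW ba] := leqP a b; rewrite ?(distnEr ab) ?(distnEl ba); lia.
Qed.

(** * From packings to the chromatic number *)

Import Order.TTheory GRing.Theory Num.Theory.
Local Open Scope ring_scope.

Theorem theorem1 (n s r : nat) (F : {set {set 'I_n}})
  (n_ge1 : (1 <= n)%N) (s_ge1 : (1 <= s)%N) (r_ge2 : (2 <= r)%N)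
  (r_pow2 : exists a : nat, r = (2 ^ a)%N)
  (r_dvd_s : (r %| s)%N)
  (F_nonempty : forall A : {set 'I_n}, A \in F -> A != set0) :
  Num.ceil ((ecd s F)%:R / (r%:R - 1) : rat)
    <= (chromatic_number (kneser r (stable_part s F)))%:Z.
Proof.
have F0 : set0 \notin F by apply/negP => /F_nonempty; rewrite eqxx.
set k := chromatic_number _.
have [c /forall_inP c_proper] : exists c : {ffun _ -> 'I_k},
    [forall E in kneser r (stable_part s F), ~~ monochromatic c E].
  by apply/existsP/chromatic_colorable => E; apply: kneser_edge_gt1.
(* The coloring is extended by 0 from the vertex subtype to all sets. *)
pose col A : nat := if insub A is Some v then c v else 0%N.
have colE v : col (val v) = c v by rewrite /col valK.
have bound : packing_bound r s.
  have [a ra] := r_pow2; have /dvdnP[m sm] := r_dvd_s.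
  have m_gt0 : (0 < m)%N by case: m sm s_ge1 => // ->.
  by rewrite sm mulnC ra; apply: packing_bound_pow2.
have [A AF|E|h part] := bound n k F col F0.
- by rewrite /col insubT.
- apply/negP => /mono_packingP[cE sE dE mE].
  pose E' := [set v : {A | A \in stable_part s F} | val v \in E].
  have /negP[] : ~~ monochromatic c E'.
    apply: c_proper; rewrite inE; apply/andP; split.
      rewrite -cE -(card_imset _ val_inj); apply/eqP; congr #|pred_of_set _|.
      apply/setP => A; apply/imsetP/idP => [[v]|AE]; first by rewrite inE => ? ->.
      by exists (Sub A (sE _ AE)); rewrite ?inE SubK.
    apply/forall_inP => A; rewrite inE => AE; apply/forall_inP => B; rewrite inE => BE.
    by apply/implyP => neq; apply: dE; rewrite ?(inj_eq val_inj).
  apply/forall_inP => A; rewrite inE => AE; apply/forall_inP => B; rewrite inE => BE.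
  by apply/eqP/val_inj; rewrite /= -!colE; apply: mE.
have le_ecd := equipartition_ecd F0 part.
(* A ceiling is at most an integer as soon as the number itself is, so clearing the denominator
   leaves [le_ecd]. *)
rewrite ceil_le_int -[1]/(1%:R) -natrB ?(ltnW r_ge2) // subn1.
rewrite ler_pdivrMr ?ltr0n; last by case: (r) r_ge2 => // -[].
by rewrite -pmulrn -natrM ler_nat.
Qed.
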